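(* Let $n\ge 2$, let $d,x$ be positive integers, and let $S\in\mathbb{T}(n,d;x)'$. Then (i) $h^1(\mathcal{I}_{2S}(d+1))=0$; (ii) $S\notin\mathbb{T}(n,t;x)$ for any $t\ge d+1$; (iii) $S\notin\mathbb{T}(n,t;x)'$ for any $t\le d-1$.
   Context: We work over an algebraically closed field of characteristic $0$. For a finite set $S\subset\mathbb{P}^n$, $\langle S\rangle$ is its linear span, and $2S\subset\mathbb{P}^n$ is the zero-dimensional scheme defined by the ideal sheaf $(\mathcal{I}_S)^2$ (the union of the double points supported at $S$). For a closed subscheme $Z\subset\mathbb{P}^n$, $h^i(\mathcal{I}_Z(d))=\dim H^i(\mathbb{P}^n,\mathcal{I}_Z(d))$. $\mathbb{T}(n,d;x)$ is the set of all subsets $S\subset\mathbb{P}^n$ of cardinality $x$ such that $h^0(\mathcal{I}_{2S}(d))>0$, $h^1(\mathcal{I}_{2S}(d))>0$ and $\langle S\rangle=\mathbb{P}^n$. $\mathbb{T}(n,d;x)'$ (the minimally Terracini sets) is the set of all $S\in\mathbb{T}(n,d;x)$ such that $h^1(\mathcal{I}_{2A}(d))=0$ for all $A\subsetneq S$. *)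

(* Defs.v *)
From HB Require Import structures.
From mathcomp Require Import all_boot all_order all_algebra.
From mathcomp Require Import finmap.
From mathcomp Require Import mpoly.

Set Implicit Arguments.
Unset Strict Implicit.
Unset Printing Implicit Defensive.

Import Order.TTheory GRing.Theory Num.Theory.

Local Open Scope ring_scope.

(* Points of P^n are the lines of k^(n+1). *)
Definition proj_space (k : fieldType) (n : nat) :=
  {L : {vspace 'rV[k]_n.+1} | \dim L == 1%N}.

Definition linear_span (k : fieldType) (n : nat) (S : {fset proj_space k n}) :
    {vspace 'rV[k]_n.+1} :=
  (\sum_(p <- enum_fset S) val p)%VS.

Definition vanishing_ideal (k : fieldType) (n : nat)
    (S : {fset proj_space k n}) (f : {mpoly k[n.+1]}) : Prop :=
  forall p, p \in S -> forall v : 'rV[k]_n.+1, v \in val p ->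
    f.@[fun i => v 0 i] = 0.

Definition ideal_square (k : fieldType) (n : nat)
    (I : {mpoly k[n.+1]} -> Prop) (f : {mpoly k[n.+1]}) : Prop :=
  exists m (a b : 'I_m -> {mpoly k[n.+1]}),
    [/\ forall j, I (a j), forall j, I (b j) & f = \sum_(j < m) a j * b j].

(* I(S)^2, whose associated sheaf on P^n is the ideal sheaf of 2S. *)
Definition double_ideal (k : fieldType) (n : nat) (S : {fset proj_space k n}) :
    {mpoly k[n.+1]} -> Prop :=
  ideal_square (vanishing_ideal S).

(* Cohomology of the sheaf I~(d) attached to a homogeneous ideal I, computed by
   the alternating Cech complex of the standard affine cover U_i = {x_i != 0}
   of P^n.  A p-cochain is indexed by the (p+1)-element sets sigma of indices;
   values at sets of other cardinalities are irrelevant.  All sections live in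
   the field k(x_0, ..., x_n). *)
Section Cech.
Variables (k : fieldType) (n : nat).
Variables (I : {mpoly k[n.+1]} -> Prop) (d : int).

Notation frac := {fraction {mpoly k[n.+1]}}.

(* Sections of I~(d) over the intersection of the U_i, i in sigma: the degree d
   part of the localization of I at the product of the x_i, i in sigma. *)
Definition twist_section (sigma : {set 'I_n.+1}) (g : frac) : Prop :=
  exists (N e : nat) (F : {mpoly k[n.+1]}),
    [/\ I F, F \is e.-homog, e%:Z = d + (N * #|sigma|)%:Z
      & g = tofrac F / tofrac (\prod_(i in sigma) 'X_i) ^+ N].

Definition cech_cochain (p : nat) (c : {set 'I_n.+1} -> frac) : Prop :=
  forall sigma : {set 'I_n.+1}, #|sigma| = p.+1 ->
    twist_section sigma (c sigma).

Definition cech_diff (c : {set 'I_n.+1} -> frac) (tau : {set 'I_n.+1}) : frac :=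
  \sum_(i in tau) (-1) ^+ #|[set j in tau | (j < i)%N]| * c (tau :\ i)%SET.

Definition cech_cocycle (p : nat) (c : {set 'I_n.+1} -> frac) : Prop :=
  cech_cochain p c /\
  forall tau : {set 'I_n.+1}, #|tau| = p.+2 -> cech_diff c tau = 0.

Definition cech_coboundary (p : nat) (c : {set 'I_n.+1} -> frac) : Prop :=
  match p with
  | 0 => forall sigma : {set 'I_n.+1}, #|sigma| = 1%N -> c sigma = 0
  | q.+1 => exists2 b, cech_cochain q b &
      forall sigma : {set 'I_n.+1}, #|sigma| = q.+2 -> c sigma = cech_diff b sigma
  end.

(* dim H^p >= m: there are m cocycles whose classes are linearly independent. *)
Definition cohom_dim_ge (p m : nat) : Prop :=
  exists u : 'I_m -> {set 'I_n.+1} -> frac,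
    (forall j, cech_cocycle p (u j)) /\
    forall lam : 'I_m -> k,
      cech_coboundary p
        (fun sigma => \sum_(j < m) tofrac (lam j)%:MP * u j sigma) ->
      forall j, lam j = 0.

Definition cohom_dim_eq (p m : nat) : Prop :=
  cohom_dim_ge p m /\ ~ cohom_dim_ge p m.+1.

End Cech.

(* h^p(I_{2S}(d)) > 0 and h^p(I_{2S}(d)) = 0 *)
Definition h_double_pos (k : fieldType) (n p : nat)
    (S : {fset proj_space k n}) (d : int) : Prop :=
  cohom_dim_ge (double_ideal S) d p 1.

Definition h_double_eq0 (k : fieldType) (n p : nat)
    (S : {fset proj_space k n}) (d : int) : Prop :=
  cohom_dim_eq (double_ideal S) d p 0.

Definition terracini (k : fieldType) (n : nat) (d : int) (x : nat)
    (S : {fset proj_space k n}) : Prop :=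
  [/\ #|` S|%fset = x, h_double_pos 0 S d, h_double_pos 1 S d
    & linear_span S = fullv].

Definition minimally_terracini (k : fieldType) (n : nat) (d : int) (x : nat)
    (S : {fset proj_space k n}) : Prop :=
  terracini d x S /\
  forall A : {fset proj_space k n}, (A `<` S)%fset -> h_double_eq0 1 A d.

(* Main.v *)
Require Import Defs.
From HB Require Import structures.
From mathcomp Require Import all_boot all_order all_algebra.
From mathcomp Require Import finmap.
From mathcomp Require Import mpoly.
From mathcomp Require Import ring zify.

Set Implicit Arguments.
Unset Strict Implicit.
Unset Printing Implicit Defensive.

Import Order.TTheory GRing.Theory Num.Theory.

Local Open Scope ring_scope.

(** Everything is translated into a statement about derivatives of forms.  A
    dependency between the 1-jets at a finite set S, in degree d, attaches to
    every P in S a vector u_P such that the sum over S of the derivatives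
    of F at P along u_P vanishes for all forms F of degree d.  For d > 0 and in
    characteristic 0, Euler's identity recovers the value of a form of degree d
    from its gradient, so gradients carry the whole 1-jets, and h^1(I_2S(d)) = 0
    holds exactly when every dependency in degree d is zero
    ([h1_zero_jets_independent] and [jets_independent_h1_zero]).

    The heart of the matter is then [jets_independent_of_minimal].  Contracting a
    dependency u of degree d + 1 with a linear form l (that is, testing it on the
    multiples l G only) gives the dependency
      d l(P) u_P + l(u_P) P
    of degree d.  By minimality, a dependency of degree d that vanishes at one
    point of S vanishes at all of them.  Hence if u vanishes at one point, all its
    contractions vanish, which forces u = 0.  If u vanishes nowhere, fix P in S;
    since n >= 2 some nonzero l kills both P and u_P, so its contraction vanishes
    at P, hence at every Q in S, and u_Q <> 0 then gives l(Q) = 0.  So S lies in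
    the hyperplane l = 0, although it spans.  This proves (i).  The
    same contraction shows that independence of 1-jets passes from a degree to
    the next ([jets_independentS]), whence (ii), and (iii) for t > 0: a set
    minimal for t < d would have independent jets in degree d.  For t <= 0 there
    is no nonzero section of I_2S(t) at all ([h0_nonpos_zero]).

    Between jets and Cech cohomology there are two steps.  Given a nonzero
    dependency, a form whose pairing with it at one point is nonzero is
    multiplied by bump forms supported at that point; this gives local sections
    of O(d) on the charts whose differences are sections of I_2S(d), and this
    cocycle cannot bound.  Conversely, a cocycle bounds in O(d) because
    H^1(O(d)) = 0 ([line_bundle_H1]); independence of the jets then provides one
    global form which corrects the 1-jets of the bounding cochain at all points
    of S.  As the sections are written with the ideal I(S)^2, which need not be
    saturated, both steps also use that a form singular along S falls into I(S)^2
    after multiplication by a power of a coordinate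
    ([singular_times_power_in_square]). *)

(** * Directional derivatives and singular points of forms *)

Section Forms.
Variables (k : fieldType) (n : nat).
Implicit Types (F G : {mpoly k[n]}) (P u l : 'rV[k]_n).

Local Notation ev P F := (F.@[fun i => P 0 i]).

Definition dirder u P F : k := \sum_a u 0 a * ev P F^`M(a).

Lemma dirder_is_linear u P : linear_for *%R (dirder u P).
Proof.
move=> c F G; rewrite /dirder mulr_sumr -big_split /=; apply: eq_bigr => a _.
by rewrite mderivD mderivZ mevalD mevalZ; ring.
Qed.

HB.instance Definition _ u P :=
  GRing.isLinear.Build k {mpoly k[n]} k *%R (dirder u P) (dirder_is_linear u P).

Lemma dirderM u P F G :
  dirder u P (F * G) = dirder u P F * ev P G + ev P F * dirder u P G.
Proof.
rewrite /dirder mulr_suml mulr_sumr -big_split /=; apply: eq_bigr => a _.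
by rewrite mderivM mevalD !mevalM; ring.
Qed.

Lemma dirderX u P F m :
  dirder u P (F ^+ m) = m%:R * ev P F ^+ m.-1 * dirder u P F.
Proof.
elim: m => [|m IH].
  rewrite expr0 !mul0r /dirder big1 // => a _.
  by rewrite -mpolyC1 mderivC meval0 mulr0.
rewrite exprS dirderM IH rmorphXn /= -natr1; case: m {IH} => [|m] /=.
  by rewrite !expr0 !mul0r; ring.
by rewrite exprS; ring.
Qed.

Definition linform l : {mpoly k[n]} := \sum_a l 0 a *: 'X_a.
Definition dot u l : k := \sum_a u 0 a * l 0 a.

Lemma ev_linform l P : ev P (linform l) = dot l P.
Proof.
by rewrite raddf_sum /=; apply: eq_bigr => a _; rewrite mevalZ mevalXU.
Qed.

Lemma dirder_mvar u P a : dirder u P 'X_a = u 0 a.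
Proof.
rewrite /dirder (bigD1 a) //= big1 => [|b ba]; rewrite mderivX mevalZ mnm1E.
  have -> : (U_(a) - U_(a) = 0)%MM by apply/mnmP => b; rewrite mnmBE mnm0E subnn.
  by rewrite eqxx mpolyX0 meval1 !mulr1 addr0.
by rewrite eq_sym (negPf ba) mul0r mulr0.
Qed.

Lemma dirder_linform u P l : dirder u P (linform l) = dot l u.
Proof.
by rewrite linear_sum; apply: eq_bigr => a _; rewrite linearZ /= dirder_mvar.
Qed.

Lemma dhomog_mvar a : ('X_a : {mpoly k[n]}) \is 1.-homog.
Proof. by rewrite dhomogX /= mdeg1. Qed.

Lemma dhomog_mvarX a N : ('X_a ^+ N : {mpoly k[n]}) \is N.-homog.
Proof. by have := dhomogMn N (dhomog_mvar a); rewrite mul1n. Qed.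

Lemma dhomog_linform l : linform l \is 1.-homog.
Proof. by rewrite rpred_sum // => a _; rewrite dhomogZ // dhomog_mvar. Qed.

Lemma euler_identity d P F : F \is d.-homog -> dirder P P F = d%:R * ev P F.
Proof.
move=> /dhomogP hF; have {}hF m : m \in msupp F -> mdeg m = d by apply: hF.
rewrite (mpolyE F) linear_sum raddf_sum /= mulr_sumr.
apply: eq_big_seq => m mF; rewrite linearZ mevalZ mulrCA /=; congr (_ * _).
rewrite -(hF _ mF) mdegE natr_sum mulr_suml; apply: eq_bigr => a _.
rewrite mderivX mevalZ; case: (posnP (m a)) => [->|ma]; first by rewrite !mul0r mulr0.
rewrite mulrCA; congr (_ * _).
rewrite -{2}(@submK _ U_(a) m) ?lep1mP ?lt0n_neq0 //.
by rewrite mpolyXD mevalM mevalXU mulrC.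
Qed.

Lemma ev_scale d c P F : F \is d.-homog -> ev (c *: P) F = c ^+ d * ev P F.
Proof.
move=> /dhomogP hF; have {}hF m : m \in msupp F -> mdeg m = d by apply: hF.
rewrite !mevalE mulr_sumr; apply: eq_big_seq => m mF.
rewrite mulrCA; congr (_ * _); rewrite -(hF _ mF) mdegE -prodrXr -big_split /=.
by apply: eq_bigr => a _; rewrite mxE exprMn.
Qed.

(** For F homogeneous this says that F lies in the square of the ideal of the
    line spanned by P, that is, that its hypersurface contains the double point. *)
Definition singular_at P F := ev P F = 0 /\ forall u, dirder u P F = 0.

Lemma singular_atD P F G :
  singular_at P F -> singular_at P G -> singular_at P (F + G).
Proof.
move=> [F0 F1] [G0 G1]; split=> [|u]; first by rewrite mevalD F0 G0 addr0.
by rewrite linearD /= F1 G1 addr0.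
Qed.

Lemma singular_atMl P F G : singular_at P F -> singular_at P (G * F).
Proof.
move=> [F0 F1]; split=> [|u]; first by rewrite mevalM F0 mulr0.
by rewrite dirderM F0 F1 !mulr0 addr0.
Qed.

Lemma singular_atB P F G :
  singular_at P F -> singular_at P G -> singular_at P (F - G).
Proof.
by move=> hF hG; apply: singular_atD; rewrite // -mulN1r; apply: singular_atMl.
Qed.

Lemma singular_atM P F G : ev P F = 0 -> ev P G = 0 -> singular_at P (F * G).
Proof.
move=> F0 G0; split=> [|u]; first by rewrite mevalM F0 mul0r.
by rewrite dirderM F0 G0 mulr0 mul0r addr0.
Qed.

(** Local sections are compared after clearing denominators; this is what lets
    the denominators be removed again. *)
Lemma singular_at_cancel P F G :
  ev P G != 0 -> singular_at P (G * F) -> singular_at P F.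
Proof.
move=> G0 [h0 h1]; have F0 : ev P F = 0.
  by move/eqP: h0; rewrite mevalM mulf_eq0 (negPf G0) => /eqP.
split=> // u; have /eqP := h1 u.
by rewrite dirderM F0 mulr0 add0r mulf_eq0 (negPf G0) => /eqP.
Qed.

End Forms.

(** * Taylor expansion along a line through the origin *)

Section Taylor.
Variables (k : fieldType) (n : nat).
Implicit Types (F G : {mpoly k[n]}) (P u l : 'rV[k]_n).

Local Notation ev P F := (F.@[fun i => P 0 i]).

(** When y is a linear form with y(P) = 1, this substitutes for the variables
    their projection onto the line of P, along the hyperplane y = 0. *)
Definition radial P (y : {mpoly k[n]}) F : {mpoly k[n]} :=
  F \mPo [tuple P 0 i *: y | i < n].

Lemma radial_homog d P y F :
  F \is d.-homog -> radial P y F = ev P F *: y ^+ d.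
Proof.
move=> /dhomogP hF; have {}hF m : m \in msupp F -> mdeg m = d by apply: hF.
rewrite /radial comp_mpolyEX [in RHS]mevalE scaler_suml; apply: eq_big_seq => m mF.
rewrite -scalerA comp_mpolyX; congr (_ *: _).
rewrite -(hF m mF) mdegE -prodrXr -scaler_prod; apply: eq_bigr => i _.
by rewrite tnth_mktuple exprZn.
Qed.

Lemma dhomog_mderiv d a F : F \is d.-homog -> F^`M(a) \is d.-1.-homog.
Proof.
move=> /dhomogP hF; apply/dhomogP => m.
rewrite mcoeff_msupp mcoeff_deriv => nz.
have := hF (m + U_(a))%MM; rewrite mcoeff_msupp /= mdegD mdeg1 => <-.
  by rewrite addn1.
by apply: contra nz => /eqP ->; rewrite mul0rn.
Qed.

(** J plays the role of an ideal containing all products of two of the linear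
    forms X_a - P_a y.  The Taylor formula modulo J holds for constants and for
    variables, and it is stable under sums and products. *)
Section Remainder.
Variables (J : {mpoly k[n]} -> Prop).
Hypothesis J0 : J 0.
Hypothesis JD : forall F G, J F -> J G -> J (F + G).
Hypothesis JM : forall F G, J F -> J (G * F).
Variables (P : 'rV[k]_n) (y : {mpoly k[n]}).
Hypothesis J_sq : forall a b, J (('X_a - P 0 a *: y) * ('X_b - P 0 b *: y)).

Local Notation rad := (radial P y).
Let diff F := \sum_a rad F^`M(a) * ('X_a - P 0 a *: y).
Let T F := J (F - rad F - diff F).

Let radM F G : rad (F * G) = rad F * rad G.
Proof. exact: rmorphM. Qed.

Let radD F G : rad (F + G) = rad F + rad G.
Proof. exact: comp_mpolyD. Qed.

Let radC c : rad c%:MP = c%:MP.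
Proof. exact: comp_mpolyC. Qed.

Let diffM F G : diff (F * G) = diff F * rad G + rad F * diff G.
Proof.
rewrite /diff mulr_suml mulr_sumr -big_split /=; apply: eq_bigr => a _.
by rewrite mderivM radD !radM; ring.
Qed.

Let J_diff F G : J (diff F * diff G).
Proof.
rewrite mulr_suml; apply: (big_ind J) => // a _.
rewrite mulr_sumr; apply: (big_ind J) => // b _.
by rewrite mulrACA; apply: JM.
Qed.

Let TM F G : T F -> T G -> T (F * G).
Proof.
rewrite /T => hF hG; rewrite radM diffM.
have -> : F * G - rad F * rad G - (diff F * rad G + rad F * diff G) =
  G * (F - rad F - diff F) + (rad F + diff F) * (G - rad G - diff G)
  + diff F * diff G by ring.
by apply: (JD _ (J_diff F G)); apply: JD; apply: JM.
Qed.

Lemma taylor_remainder F : J (F - rad F - diff F).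
Proof.
have TC c : T c%:MP.
  rewrite /T radC subrr sub0r /diff big1 ?oppr0 // => a _.
  by rewrite mderivC -mpolyC0 radC mpolyC0 mul0r.
have T1 : T 1 by rewrite -mpolyC1.
have TX a : T 'X_a.
  rewrite /T /diff (bigD1 a) //= big1 => [|b ba]; last first.
    by rewrite mderivX mnm1E eq_sym (negPf ba) scale0r -mpolyC0 radC mpolyC0 mul0r.
  have -> : 'X_a^`M(a) = 1 :> {mpoly k[n]}.
    rewrite mderivX mnm1E eqxx scale1r -mpolyX0; congr 'X_[_].
    by apply/mnmP => b; rewrite mnmBE mnm0E subnn.
  rewrite -mpolyC1 radC mpolyC1 /radial comp_mpolyXU -tnth_nth tnth_mktuple mul1r addr0.
  by rewrite subrr.
elim/mpolyind: F => [|c m F _ _ TF]; first by rewrite -mpolyC0; apply: TC.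
have TXm : T 'X_[m].
  rewrite mpolyXE_id; apply: (big_ind T) => [|F1 F2|i _]; [exact: T1|exact: TM|].
  by elim: (m i) => [|j IH]; [exact: T1 | rewrite exprS; exact: (TM (TX i) IH)].
have TD F1 F2 : T F1 -> T F2 -> T (F1 + F2).
  rewrite /T => h1 h2; have := JD h1 h2; congr J.
  rewrite radD /diff; under [in RHS]eq_bigr do rewrite mderivD radD mulrDl.
  by rewrite big_split /=; ring.
by have := TD _ _ (TM (TC c) TXm) TF; rewrite mul_mpolyC.
Qed.

End Remainder.

(** The terms of order 0 and 1 of the Taylor expansion of a form are multiples of
    its value and of its partial derivatives at P. *)
Lemma square_of_singular (J : {mpoly k[n]} -> Prop) d P y F :
  J 0 -> (forall F G, J F -> J G -> J (F + G)) ->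
  (forall F G, J F -> J (G * F)) ->
  (forall a b, J (('X_a - P 0 a *: y) * ('X_b - P 0 b *: y))) ->
  F \is d.-homog -> singular_at P F -> J F.
Proof.
move=> J0 JD JM J_sq hF [F0 F1].
have := taylor_remainder J0 JD JM J_sq F.
rewrite (radial_homog _ _ hF) F0 scale0r subr0 big1 ?subr0 // => a _.
rewrite (radial_homog _ _ (dhomog_mderiv a hF)).
suff -> : ev P F^`M(a) = 0 by rewrite scale0r mul0r.
have := F1 (delta_mx 0 a); rewrite /dirder (bigD1 a) //= big1 => [|b ba].
  by rewrite mxE !eqxx mul1r addr0.
by rewrite mxE eqxx (negPf ba) mul0r.
Qed.

End Taylor.

(** * Division by powers of the coordinates *)

Section MonomialDivision.
Variables (k : fieldType) (n : nat).
Implicit Types (F G H : {mpoly k[n]}).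

Lemma mcoeff_mvarX_mul i N G m :
  ('X_i ^+ N * G)@_m != 0 -> (N <= m i)%N.
Proof.
rewrite mpolyXn mulrC -mcoeff_msupp (perm_mem (msuppMX _ _)).
case/mapP=> m' _ ->.
by rewrite mnmDE mulmnE mnm1E eqxx mul1n leq_addr.
Qed.

Lemma mvarX_dvd i N e F : F \is e.-homog ->
  (forall m, F@_m != 0 -> (N <= m i)%N) ->
  exists2 Q, Q \is (e - N).-homog & F = 'X_i ^+ N * Q.
Proof.
move=> /dhomogP hF hN.
have le_m m : m \in msupp F -> (U_(i) *+ N <= m)%MM.
  rewrite mcoeff_msupp => /hN Nm; apply/mnm_lepP => j.
  by rewrite mulmnE mnm1E; case: eqP => [<-|_]; rewrite ?mul1n // mul0n.
exists (\sum_(m <- msupp F) F@_m *: 'X_[m - U_(i) *+ N]); last first.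
  rewrite {1}(mpolyE F) mulr_sumr; apply: eq_big_seq => m mF.
  by rewrite -scalerAr mpolyXn -mpolyXD addmC submK // le_m.
rewrite big_seq rpred_sum // => m mF; rewrite dhomogZ // dhomogX /=.
have := hF m mF; rewrite /= -{1}(submK (le_m _ mF)) mdegD mdegMn mdeg1 mul1n => <-.
by rewrite addnK.
Qed.

(** Powers of two distinct coordinates are coprime; comparing monomials avoids
    any appeal to unique factorization. *)
Lemma mvarX_gauss i j N M e F G : i != j -> F \is e.-homog ->
  'X_j ^+ M * F = 'X_i ^+ N * G ->
  exists2 Q, Q \is (e - N).-homog & F = 'X_i ^+ N * Q.
Proof.
move=> ij hF eFG; apply: mvarX_dvd => // m Fm.
have: ('X_i ^+ N * G)@_(m + U_(j) *+ M)%MM != 0.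
  by rewrite -eFG mulrC mpolyXn addmC mcoeffMX.
by move/mcoeff_mvarX_mul; rewrite mnmDE mulmnE mnm1E eq_sym (negPf ij) addn0.
Qed.

(** The powers of three coordinates form a regular sequence: a monomial of F
    divisible by neither X_i^N nor X_j^N stays so after multiplication by X_l^N.  This is
    what makes the first cohomology of line bundles vanish on P^n for n >= 2. *)
Lemma mvarX_syzygy i j l N e F G H : i != l -> j != l -> F \is e.-homog ->
  'X_l ^+ N * F = 'X_i ^+ N * G + 'X_j ^+ N * H ->
  exists Q1 Q2, [/\ Q1 \is (e - N).-homog, Q2 \is (e - N).-homog &
    F = 'X_i ^+ N * Q1 + 'X_j ^+ N * Q2].
Proof.
move=> il jl hF eF.
(* the monomials of F divisible by X_i^N go to Q1, the other ones to Q2 *)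
pose part (p : pred 'X_{1..n}) := \sum_(m <- msupp F | p m) F@_m *: 'X_[m].
have part_homog p : part p \is e.-homog.
  rewrite /part big_seq_cond rpred_sum // => m /andP[mF _].
  by rewrite dhomogZ // dhomogX; move/dhomogP: hF => /(_ m mF)/eqP.
have part_coef p m : (part p)@_m != 0 -> p m && (F@_m != 0).
  rewrite raddf_sum /= => nz; apply/andP; split; apply: contraNT nz => hm.
    rewrite big1 // => m' pm'; rewrite mcoeffZ mcoeffX.
    by case: eqP => [em|_]; [rewrite -em pm' in hm | rewrite mulr0].
  rewrite negbK in hm; rewrite big1 // => m' _; rewrite mcoeffZ mcoeffX.
  by case: eqP => [->|_]; [rewrite (eqP hm) mul0r | rewrite mulr0].
have splitF : F = part (fun m => N <= m i)%N + part (fun m => ~~ (N <= m i)%N).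
  by rewrite {1}(mpolyE F) (bigID (fun m : 'X_{1..n} => N <= m i)%N).
case: (@mvarX_dvd i N e _ (part_homog (fun m => N <= m i)%N)) => [m|Q1 hQ1 e1].
  by case/part_coef/andP.
case: (@mvarX_dvd j N e _ (part_homog (fun m => ~~ (N <= m i)%N))) => [m|Q2 hQ2 e2].
  case/part_coef/andP=> mi Fm.
  have: ('X_i ^+ N * G + 'X_j ^+ N * H)@_(m + U_(l) *+ N)%MM != 0.
    by rewrite -eF mulrC mpolyXn addmC mcoeffMX.
  rewrite mcoeffD; case: (eqVneq ('X_i ^+ N * G)@_(m + U_(l) *+ N)%MM 0) => [->|].
    rewrite add0r => /mcoeff_mvarX_mul.
    by rewrite mnmDE mulmnE mnm1E eq_sym (negPf jl) addn0.
  move/mcoeff_mvarX_mul.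
  by rewrite mnmDE mulmnE mnm1E eq_sym (negPf il) addn0 (negPf mi).
by exists Q1, Q2; split; rewrite // -e1 -e2.
Qed.

End MonomialDivision.

(** * Finite sets of points and the square of their ideal *)

Section Points.
Variables (k : fieldType) (n : nat).
Implicit Types (p q : proj_space k n) (A : {fset proj_space k n}).
Implicit Types (F G : {mpoly k[n.+1]}) (u v l : 'rV[k]_n.+1).

Local Notation ev P F := (F.@[fun i => P 0 i]).

Definition repr_vec p : 'rV[k]_n.+1 := vpick (val p).

Lemma val_line p : val p = <[repr_vec p]>%VS.
Proof.
have dim1 : \dim (val p) = 1%N := eqP (valP p).
apply/esym/eqP; rewrite eqEdim -memvE memv_pick dim1 dim_vline /= lt0b.
by rewrite vpick0 -dimv_eq0 dim1.
Qed.

Lemma repr_vec_neq0 p : repr_vec p != 0.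
Proof. by rewrite vpick0 -dimv_eq0 (eqP (valP p)). Qed.

Lemma mem_lineP p v : reflect (exists c, v = c *: repr_vec p) (v \in val p).
Proof. by rewrite val_line; apply: vlineP. Qed.

Lemma repr_vec_inj p q c : repr_vec p = c *: repr_vec q -> p = q.
Proof.
move=> e; apply/val_inj/eqP; rewrite eqEdim (eqP (valP p)) (eqP (valP q)) leqnn andbT.
by rewrite (val_line p) -memvE; apply/mem_lineP; exists c.
Qed.

Lemma coord_neq0 p : exists i, repr_vec p 0 i != 0.
Proof. by have /rV0Pn := repr_vec_neq0 p. Qed.

Lemma vanishing_idealE A F d : F \is d.-homog ->
  vanishing_ideal A F <-> forall p, p \in A -> ev (repr_vec p) F = 0.
Proof.
move=> hF; split=> [h p pA|h p pA v /mem_lineP[c ->]].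
  by apply: (h p pA); apply: memv_pick.
by rewrite (ev_scale _ _ hF) h // mulr0.
Qed.

Lemma vanishing_idealM A F G : vanishing_ideal A F -> vanishing_ideal A (G * F).
Proof. by move=> h p pA v vp; rewrite mevalM (h p pA v vp) mulr0. Qed.

Lemma double_ideal_gen A F G :
  vanishing_ideal A F -> vanishing_ideal A G -> double_ideal A (F * G).
Proof.
by move=> hF hG; exists 1%N, (fun=> F), (fun=> G); split; rewrite ?big_ord1.
Qed.

Lemma double_ideal0 A : double_ideal A 0.
Proof.
by exists 0%N, (fun=> 0), (fun=> 0); split; rewrite ?big_ord0 // => j ? *; apply: meval0.
Qed.

Lemma double_idealD A F G :
  double_ideal A F -> double_ideal A G -> double_ideal A (F + G).
Proof.
move=> [m1 [a1 [b1 [ha1 hb1 ->]]]] [m2 [a2 [b2 [ha2 hb2 ->]]]].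
exists (m1 + m2)%N.
exists (fun j => match split j with inl i => a1 i | inr i => a2 i end).
exists (fun j => match split j with inl i => b1 i | inr i => b2 i end).
split=> [j|j|]; try by case: (split j).
rewrite big_split_ord /=; congr (_ + _); apply: eq_bigr => i _.
  by rewrite (unsplitK (inl i)).
by rewrite (unsplitK (inr i)).
Qed.

Lemma double_idealM A F G : double_ideal A F -> double_ideal A (G * F).
Proof.
move=> [m [a [b [ha hb ->]]]]; exists m, (fun j => G * a j), b; split=> // [j|].
  exact: vanishing_idealM.
by rewrite mulr_sumr; apply: eq_bigr => j _; rewrite mulrA.
Qed.

Lemma double_ideal_singular A F p :
  double_ideal A F -> p \in A -> singular_at (repr_vec p) F.
Proof.
move=> [m [a [b [ha hb ->]]]] pA.
apply: (big_ind (singular_at _)) => [|F1 F2|j _].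
- by split=> [|u]; rewrite ?meval0 ?linear0.
- exact: singular_atD.
- by apply: singular_atM; [apply: (ha j p pA) | apply: (hb j p pA)]; apply: memv_pick.
Qed.

(** A point off the line of Q has a nonzero image in the cokernel of Q, and the
    columns of the cokernel matrix are linear forms vanishing on Q. *)
Lemma separating_linform p q : q != p ->
  exists2 l, dot l (repr_vec p) != 0 & dot l (repr_vec q) = 0.
Proof.
move=> qp; have /rV0Pn[j hj] : repr_vec p *m cokermx (repr_vec q) != 0.
  rewrite -submxE; apply: contra qp => /sub_rVP[c e].
  by rewrite (repr_vec_inj e).
have dotE v : dot (col j (cokermx (repr_vec q)))^T v = (v *m cokermx (repr_vec q)) 0 j.
  by rewrite mxE; apply: eq_bigr => a _; rewrite !mxE mulrC.
by exists (col j (cokermx (repr_vec q)))^T; rewrite dotE // mulmx_coker mxE.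
Qed.

(** The degree depends on s only, so that forms for different points can be
    added. *)
Lemma separating_form p (s : seq (proj_space k n)) :
  exists2 h : {mpoly k[n.+1]}, h \is (size s).-homog &
    ev (repr_vec p) h = 1 /\
    forall q, q \in s -> q != p -> ev (repr_vec q) h = 0.
Proof.
suff [h [hh h1 h0]] : exists h : {mpoly k[n.+1]}, [/\ h \is (size s).-homog,
    ev (repr_vec p) h != 0 &
    forall q, q \in s -> q != p -> ev (repr_vec q) h = 0].
  exists ((ev (repr_vec p) h)^-1 *: h); first by rewrite dhomogZ.
  split=> [|q qs qp]; first by rewrite mevalZ mulVf.
  by rewrite mevalZ (h0 q) ?mulr0.
elim: s => [|q s [h [hh h1 h0]]].
  by exists 1; split; rewrite ?meval1 ?oner_eq0 ?dhomog1.
have [l lp lq] : exists2 l, dot l (repr_vec p) != 0 &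
    (q != p -> dot l (repr_vec q) = 0).
  have [->|/separating_linform[l lp lq]] := eqVneq q p; last by exists l.
  have [i hi] := coord_neq0 p; exists (delta_mx 0 i); last by move/eqP.
  rewrite /dot (bigD1 i) //= big1 => [|j ji]; first by rewrite !mxE !eqxx mul1r addr0.
  by rewrite mxE (negPf ji) mul0r.
exists (linform l * h); split.
- exact: (dhomogM (dhomog_linform l) hh).
- by rewrite mevalM ev_linform mulf_neq0.
move=> q'; rewrite inE mevalM ev_linform => /orP[/eqP ->|q's] q'p.
  by rewrite lq ?mul0r.
by rewrite h0 ?mulr0.
Qed.

(** Let h_p be forms of degree e with h_p(p) = 1 that vanish at the other points.
    If F is singular along A, then h_p^2 F is in I(A)^2 by the Taylor expansion of
    F at p.  A form of degree 2e differs from a linear combination of the h_p^2 by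
    an element of I(A), and the product of that element with F is in I(A)^2 since
    F is also in I(A). *)
Lemma singular_times_power_in_square A : exists M, forall d F i,
  F \is d.-homog -> (forall p, p \in A -> singular_at (repr_vec p) F) ->
  double_ideal A ('X_i ^+ M * F).
Proof.
pose e := size (enum_fset A); exists (e * 2)%N => d F i hF sF.
have /fin_all_exists[h hh] (p : A) : exists h : {mpoly k[n.+1]},
    [/\ h \is e.-homog, ev (repr_vec (val p)) h = 1 &
      forall q, q \in A -> q != val p -> ev (repr_vec q) h = 0].
  by have [h ? [? ?]] := separating_form (val p) (enum_fset A); exists h.
have h2F (p : A) : double_ideal A (h p ^+ 2 * F).
  have [hp1 hp2 hp3] := hh p.
  have [j hj] := coord_neq0 (val p).
  (* y is the linear form proportional to X_j with y(P) = 1 *)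
  pose P := repr_vec (val p); pose y : {mpoly k[n.+1]} := (P 0 j)^-1 *: 'X_j.
  pose J G := double_ideal A (h p ^+ 2 * G).
  apply: (@square_of_singular k n.+1 J d P y F _ _ _ _ hF (sF _ (valP p))); rewrite /J.
  - by rewrite mulr0; apply: double_ideal0.
  - by move=> F1 F2 h1 h2; rewrite mulrDr; apply: double_idealD.
  - by move=> F1 F2 h1; rewrite mulrCA; apply: double_idealM.
  have hl a : vanishing_ideal A (h p * ('X_a - P 0 a *: y)).
    apply/(@vanishing_idealE _ _ (e + 1)).
      by rewrite dhomogM // rpredB ?dhomog_mvar // !dhomogZ ?dhomog_mvar.
    move=> q qA; rewrite mevalM; have [->|qp] := eqVneq q (val p).
      rewrite mevalB !mevalZ !mevalXU -/P mulVf // mulr1 subrr mulr0 //.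
    by rewrite hp3 ?mul0r.
  by move=> a b; rewrite expr2 mulrACA; apply: double_ideal_gen.
(* the coefficients make X_i^(2e) agree with the combination of h_p^2 on A *)
pose c (p : A) := repr_vec (val p) 0 i ^+ (e * 2).
pose Sq := \sum_(p : A) c p *: h p ^+ 2.
have -> : 'X_i ^+ (e * 2) * F = ('X_i ^+ (e * 2) - Sq) * F + Sq * F
  by rewrite -mulrDl subrK.
apply: double_idealD.
  apply: double_ideal_gen; last by apply/(vanishing_idealE A hF) => p /sF[].
  apply/(@vanishing_idealE _ _ (e * 2)).
    rewrite rpredB ?dhomog_mvarX // rpred_sum // => p _.
    by rewrite dhomogZ // dhomogMn //; case: (hh p).
  move=> p pA; pose p' : A := [` pA]%fset.
  have -> : ev (repr_vec p) ('X_i ^+ (e * 2) - Sq) =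
      c p' - \sum_(q : A) c q * ev (repr_vec p) (h q) ^+ 2.
    rewrite mevalB rmorphXn /= mevalXU rmorph_sum; congr (_ - _).
    by apply: eq_bigr => q _; rewrite /= mevalZ rmorphXn.
  rewrite (bigD1 p') //= big1 => [|q qp].
    by have [_ -> _] := hh p'; rewrite expr1n mulr1 addr0 subrr.
  have [_ _ ->//] := hh q; rewrite ?expr0n ?mulr0 //.
  by apply: contra qp => /eqP e1; apply/eqP/val_inj; rewrite /= e1.
rewrite mulr_suml; apply: (big_ind (double_ideal A)) => [|F1 F2|p _].
- exact: double_ideal0.
- exact: double_idealD.
- by rewrite -mul_mpolyC -mulrA; apply: double_idealM.
Qed.

End Points.

(** * Linear dependencies between 1-jets *)

Section Dependencies.
Variables (k : fieldType) (n : nat).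
Implicit Types (A S : {fset proj_space k n}) (F G : {mpoly k[n.+1]}).
Implicit Types (P v l : 'rV[k]_n.+1) (u w : proj_space k n -> 'rV[k]_n.+1).

Local Notation ev P F := (F.@[fun i => P 0 i]).

Definition jet_dependency A d u := forall F, F \is d.-homog ->
  \sum_(p <- A) dirder (u p) (repr_vec p) F = 0.

(** Dual form of the surjectivity of forms of degree d onto the gradients at the
    points of A. *)
Definition jets_independent A d :=
  forall u, jet_dependency A d u -> forall p, p \in A -> u p = 0.

Lemma dirder_lincomb a v b l P F :
  dirder (a *: v + b *: l) P F = a * dirder v P F + b * dirder l P F.
Proof.
rewrite /dirder !mulr_sumr -big_split /=; apply: eq_bigr => i _.
by rewrite !mxE; ring.
Qed.

Lemma dot_lincomb l a v b P :
  dot l (a *: v + b *: P) = a * dot l v + b * dot l P.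
Proof.
rewrite /dot !mulr_sumr -big_split /=; apply: eq_bigr => i _.
by rewrite !mxE; ring.
Qed.

(** The value at P of the contraction by l of a dependency that takes the value v
    there.  The functional G |-> d D_v (l G)(P) on forms of degree d is
    again a directional derivative at P, because Euler's identity turns d G(P)
    into the derivative of G along P. *)
Definition contraction d l P v := (d%:R * dot l P) *: v + dot l v *: P.

Lemma dirder_contraction d l P v G : G \is d.-homog ->
  dirder (contraction d l P v) P G = d%:R * dirder v P (linform l * G).
Proof.
move=> hG; rewrite dirder_lincomb (euler_identity _ hG) dirderM.
by rewrite ev_linform dirder_linform; ring.
Qed.

Lemma jet_dependency_contraction A d u l : jet_dependency A d.+1 u ->
  jet_dependency A d (fun p => contraction d l (repr_vec p) (u p)).
Proof.
move=> dep G hG; under eq_bigr do rewrite (dirder_contraction _ _ _ hG).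
by rewrite -mulr_sumr (dep _ (dhomogM (dhomog_linform l) hG)) mulr0.
Qed.

Lemma jet_dependency_fsetD1 A d u p : jet_dependency A d u -> u p = 0 ->
  jet_dependency (A `\ p)%fset d u.
Proof.
move=> dep up0 F hF; have [pA|pA] := boolP (p \in A); last first.
  by rewrite mem_fsetD1 // dep.
have := dep F hF; rewrite (big_fsetD1 p) //= up0.
by rewrite {1}/dirder big1 ?add0r // => a _; rewrite mxE mul0r.
Qed.

Lemma orthogonal_linform P v : (2 <= n)%N ->
  exists2 l, l != 0 & dot l P = 0 /\ dot l v = 0.
Proof.
move=> n2; pose M := col_mx P v; pose l := nz_row (kermx M^T).
have lM : l *m M^T = 0 by apply/sub_kermxP/nz_row_sub.
exists l.
  rewrite nz_row_eq0 -mxrank_eq0 mxrank_ker subn_eq0 -ltnNge.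
  by apply: leq_ltn_trans (rank_leq_col _) _.
have dotE x : dot l x = (l *m x^T) 0 0.
  by rewrite mxE; apply: eq_bigr => a _; rewrite mxE.
move: lM; rewrite tr_col_mx mul_mx_row -(row_mx0 k 1) => /eq_row_mx[e1 e2].
by rewrite !dotE e1 e2 mxE.
Qed.

Lemma dot_eq0_of_span S l : linear_span S = fullv ->
  (forall p, p \in S -> dot l (repr_vec p) = 0) -> l = 0.
Proof.
move=> span hl; pose K := lker (linfun (@mulmxr k 1 _ _ l^T)).
have dotE x : dot l x = (x *m l^T) 0 0.
  by rewrite mxE; apply: eq_bigr => a _; rewrite mxE mulrC.
have memK v : (v \in K) = (v *m l^T == 0) by rewrite memv_ker lfunE.
have full : (fullv <= K)%VS.
  rewrite -span /linear_span big_seq; apply: (big_ind (fun U => (U <= K)%VS)).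
  - exact: sub0v.
  - by move=> U V hU hV; rewrite subv_add hU.
  move=> p pS; rewrite val_line -memvE memK; apply/eqP/matrixP => i j.
  by rewrite !ord1 -dotE hl // mxE.
apply/rowP => i; have := subvP full (delta_mx 0 i) (memvf _).
rewrite memK -rowE => /eqP/rowP/(_ 0); rewrite !mxE //.
Qed.

Section Char0.
Hypothesis char0 : [pchar k] =i pred0.

Lemma natr_neq0 d : (d.+1%:R : k) != 0.
Proof. by have /pcharf0P -> := char0. Qed.

(** Choosing for l a coordinate that does not vanish at P, the corresponding
    coordinate of v is multiplied by (d + 1) l(P), hence is 0, and then v is
    multiplied by d l(P). *)
Lemma contraction_injective d P v : (0 < d)%N -> P != 0 ->
  (forall l, contraction d l P v = 0) -> v = 0.
Proof.
case: d => // d _ /rV0Pn[i Pi] h; have := h (delta_mx 0 i).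
have dotE x : dot (delta_mx 0 i) x = x 0 i.
  rewrite /dot (bigD1 i) //= big1 => [|j ji]; first by rewrite mxE !eqxx mul1r addr0.
  by rewrite mxE (negPf ji) mul0r.
rewrite /contraction !dotE => e; have vi : v 0 i = 0.
  move/rowP/(_ i): e; rewrite !mxE => e.
  have /eqP : d.+2%:R * P 0 i * v 0 i = 0 by rewrite -e -[d.+2%:R]natr1; ring.
  by rewrite !mulf_eq0 (negPf (natr_neq0 _)) (negPf Pi) => /eqP.
move: e; rewrite vi scale0r addr0 => /eqP.
by rewrite scaler_eq0 mulf_eq0 (negPf (natr_neq0 _)) (negPf Pi) => /eqP.
Qed.

Lemma jets_independentS A d : (0 < d)%N ->
  jets_independent A d -> jets_independent A d.+1.
Proof.
move=> d0 ind u dep p pA; apply: (contraction_injective d0 (repr_vec_neq0 p)) => l.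
exact: ind (jet_dependency_contraction l dep) _ pA.
Qed.

Lemma jets_independent_leq A d e : (0 < d)%N -> (d <= e)%N ->
  jets_independent A d -> jets_independent A e.
Proof.
move=> d0 /subnK <- ind; elim: (e - d)%N => [//|j].
by rewrite addSn; apply: jets_independentS; rewrite addn_gt0 d0 orbT.
Qed.

(** Minimality makes a dependency of degree d vanish everywhere as soon as it
    vanishes at one point; the contractions of a dependency of degree d + 1 by
    well chosen linear forms have such a zero. *)
Lemma jets_independent_of_minimal S d : (0 < d)%N -> (2 <= n)%N ->
  (forall A, (A `<` S)%fset -> jets_independent A d) ->
  linear_span S = fullv -> jets_independent S d.+1.
Proof.
move=> d0 n2 ind span u dep.
have full_support w : jet_dependency S d w ->
    forall q, q \in S -> w q = 0 -> forall p, p \in S -> w p = 0.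
  move=> depw q qS wq p pS; have [->//|pq] := eqVneq p q.
  apply: (ind _ (fproperD1 qS) w (jet_dependency_fsetD1 depw wq)).
  by rewrite in_fsetD1 pq.
have depc l := jet_dependency_contraction l dep.
have [/hasP[q qS /eqP uq]|/hasPn nz] := boolP (has (fun q => u q == 0) (enum_fset S)).
  move=> p pS; apply: (contraction_injective d0 (repr_vec_neq0 p)) => l.
  apply: (full_support _ (depc l) q qS _ p pS).
  rewrite /contraction uq scaler0 add0r /dot big1 ?scale0r // => a _.
  by rewrite mxE mulr0.
move=> p pS; have [l l0 [lP lu]] := orthogonal_linform (repr_vec p) (u p) n2.
case/eqP: l0; apply: (dot_eq0_of_span span) => q qS.
have cp : contraction d l (repr_vec p) (u p) = 0.
  by rewrite /contraction lP lu mulr0 !scale0r addr0.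
have cq := full_support _ (depc l) p pS cp q qS.
have uq := nz q qS.
apply/eqP; apply: contraNT uq => lq.
(* if l(q) <> 0, applying l to the zero contraction at q gives
   (d + 1) l(q) l(u_q) = 0, and then d l(q) u_q = 0 remains *)
have lu0 : dot l (u q) = 0.
  have : dot l (contraction d l (repr_vec q) (u q)) = 0.
    by rewrite cq /dot big1 // => a _; rewrite mxE mulr0.
  have -> : dot l (contraction d l (repr_vec q) (u q)) =
      d.+1%:R * dot l (repr_vec q) * dot l (u q).
    by rewrite dot_lincomb -natr1; ring.
  by move/eqP; rewrite !mulf_eq0 (negPf (natr_neq0 _)) (negPf lq) => /eqP.
move: cq; rewrite /contraction lu0 scale0r addr0 => /eqP.
rewrite scaler_eq0 mulf_eq0 (negPf lq) orbF.
by case: (d) d0 => // d' _; rewrite (negPf (natr_neq0 _)).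
Qed.

End Char0.

Lemma fredholm_alternative (I J : finType) (c : I -> J -> k) (t : J -> k) :
  (forall w : J -> k, (forall i, \sum_j c i j * w j = 0) -> forall j, w j = 0) ->
  exists v : I -> k, forall j, \sum_i v i * c i j = t j.
Proof.
move=> inj.
pose M := \matrix_(i < #|I|, j < #|J|) c (enum_val i) (enum_val j).
have full : row_full M.
  rewrite /row_full -mxrank_tr -/(row_free _) -kermx_eq0.
  apply/eqP/row_matrixP => r; rewrite row0.
  have : row r (kermx M^T) *m M^T = 0 by apply/sub_kermxP/row_sub.
  move: (row r _) => x xM; apply/rowP => j; rewrite mxE.
  have := inj (fun j => x 0 (enum_rank j)) _ (enum_val j).
  rewrite enum_valK; apply => i.
  rewrite (reindex_onto (@enum_val J predT) enum_rank) /= => [|? _]; last first.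
    exact: enum_rankK.
  have /rowP/(_ (enum_rank i)) := xM; rewrite !mxE; apply: etrans.
  apply: eq_big => [j'|j' _]; first by rewrite enum_valK eqxx.
  by rewrite enum_valK !mxE enum_rankK mulrC.
have [x xM] := submxP (submx_full (\row_j t (enum_val j)) full).
exists (fun i => x 0 (enum_rank i)) => j.
have /rowP/(_ (enum_rank j)) := xM; rewrite !mxE enum_rankK => ->.
rewrite (reindex_onto (@enum_val I predT) enum_rank) /= => [|? _]; last first.
  exact: enum_rankK.
apply: eq_big => [i|i _]; first by rewrite enum_valK eqxx.
by rewrite enum_valK !mxE enum_rankK.
Qed.

(** Independent functionals take arbitrary values; forms of degree d are indexed
    by their finitely many coefficients. *)
Lemma jets_independent_surjective A d (t : proj_space k n -> 'rV[k]_n.+1) :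
  jets_independent A d -> exists2 F, F \is d.-homog &
  forall p, p \in A -> forall v, dirder v (repr_vec p) F = dot v (t p).
Proof.
move=> ind.
pose grad m (p : proj_space k n) a : k :=
  if mdeg m == d then ev (repr_vec p) 'X_[m]^`M(a) else 0.
pose c (m : 'X_{1..n.+1 < d.+1}) (j : A * 'I_n.+1) := grad m (val j.1) j.2.
have [w cw [p a]|v hv] := @fredholm_alternative _ _ c (fun j => t (val j.1) 0 j.2).
  pose u p := if insub p is Some q then \row_a w (q, a) else 0.
  have uE (q : A) : u (val q) = \row_a w (q, a) by rewrite /u valK.
  suff dep : jet_dependency A d u.
    by have /rowP/(_ a) := ind u dep _ (valP p); rewrite uE !mxE.
  move=> F hF; rewrite (mpolyE F); under eq_bigr do rewrite linear_sum /=.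
  rewrite exchange_big big_seq big1 // => m mF.
  have dm : mdeg m = d by move/dhomogP: hF => /(_ m mF).
  under eq_bigr do rewrite linearZ /=.
  rewrite -mulr_sumr big_seq_fsetE /=.
  have ltm : (mdeg m < d.+1)%N by rewrite dm.
  apply/eqP; rewrite mulf_eq0; apply/orP; right; apply/eqP.
  apply: etrans (cw (BMultinom ltm)).
  rewrite /dirder pair_bigA; apply: eq_bigr => -[q b] _ /=.
  by rewrite uE mxE /c /grad /= dm eqxx mulrC.
exists (\sum_m (if mdeg (val m) == d then v m else 0) *: 'X_[val m]).
  rewrite rpred_sum // => m _; case: eqP => [dm|_]; last by rewrite scale0r rpred0.
  by rewrite dhomogZ // dhomogX; apply/eqP.
move=> p pA u; rewrite linear_sum /dirder /dot /=.
under eq_bigr do rewrite linearZ /= /dirder mulr_sumr.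
rewrite exchange_big; apply: eq_bigr => a _.
rewrite -(hv ([` pA]%fset, a)) mulr_sumr; apply: eq_bigr => m _.
by rewrite /c /grad /=; case: ifP => _; ring.
Qed.

End Dependencies.

(** * Cech cochains on pairs of charts, and the cohomology of line bundles *)

Section FieldIdentities.
Variable K : fieldType.
Implicit Types x y z f g h p q : K.

Lemma fraction_lift x y f : x != 0 -> y != 0 -> f / x = (y * f) / (x * y).
Proof. by move=> x0 y0; field; rewrite x0 y0. Qed.

Lemma cocycle_numerators x y z f g h : x != 0 -> y != 0 -> z != 0 ->
  f / (x * z) = g / (y * z) + h / (x * y) -> z * h = x * - g + y * f.
Proof.
move=> x0 y0 z0 /(congr1 (fun a => a * (x * y * z))) e.
have -> : y * f = f / (x * z) * (x * y * z) by field; rewrite x0 z0.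
by rewrite e; field; rewrite x0 y0 z0.
Qed.

Lemma fraction_split x y p q : x != 0 -> y != 0 ->
  (x * p + y * q) / (x * y) = p / y - - q / x.
Proof. by move=> x0 y0; field; rewrite x0 y0. Qed.

Lemma fraction_sum x y z f q : x != 0 -> y != 0 -> z != 0 ->
  f / (y * z) + q / x = (x * f + y * z * q) / (y * x) / z.
Proof. by move=> x0 y0 z0; field; rewrite x0 y0 z0. Qed.

Lemma fraction_sub x y f g : x != 0 -> y != 0 ->
  f / x - g / y = (y * f - x * g) / (y * x).
Proof. by move=> x0 y0; field; rewrite x0 y0. Qed.

End FieldIdentities.

Section CechPairs.
Variables (k : fieldType) (n : nat).
Local Notation frac := {fraction {mpoly k[n.+1]}}.
Implicit Types (I : {mpoly k[n.+1]} -> Prop) (F G H : {mpoly k[n.+1]}).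
Implicit Types (c : {set 'I_n.+1} -> frac) (g : frac).

Definition coordf (i : 'I_n.+1) : frac := tofrac 'X_i.

Lemma coordf_neq0 i N : coordf i ^+ N != 0.
Proof.
rewrite expf_neq0 // tofrac_eq0; apply/negP => /eqP/(congr1 (mcoeff U_(i))).
by rewrite mcoeffX eqxx mcoeff0 => /eqP; rewrite oner_eq0.
Qed.

Lemma twist_section1P I d i g :
  twist_section I d%:Z [set i] g <->
  exists N F, [/\ I F, F \is (d + N).-homog & g = tofrac F / coordf i ^+ N].
Proof.
rewrite /twist_section cards1 big_set1; split.
  move=> [N [e [F [IF hF he ->]]]]; exists N, F; split=> //.
  by move: he hF; rewrite muln1 -PoszD => -[->].
by move=> [N [F [IF hF ->]]]; exists N, (d + N)%N, F; rewrite muln1.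
Qed.

Lemma twist_section2P I d i j g : i != j ->
  twist_section I d%:Z [set i; j] g <->
  exists N F, [/\ I F, F \is (d + N * 2).-homog
    & g = tofrac F / (coordf i * coordf j) ^+ N].
Proof.
move=> ij; rewrite /twist_section cards2 ij big_setU1 ?inE //= big_set1 tofracM.
split.
  move=> [N [e [F [IF hF he ->]]]]; exists N, F; split=> //.
  by move: he hF; rewrite -PoszD => -[->].
by move=> [N [F [IF hF ->]]]; exists N, (d + N * 2)%N, F.
Qed.

Lemma sorted_enum_set (s : {set 'I_n.+1}) : sorted ltn [seq val i | i <- enum s].
Proof.
have -> : enum s = filter (mem s) (enum 'I_n.+1) by rewrite enumT.
apply: (subseq_sorted ltn_trans (map_subseq val (filter_subseq _ _))).
by rewrite val_enum_ord iota_ltn_sorted.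
Qed.

Lemma card2_sorted (s : {set 'I_n.+1}) : #|s| = 2 ->
  exists i j : 'I_n.+1, (i < j)%N /\ s = [set i; j].
Proof.
rewrite cardE; have := sorted_enum_set s; have := mem_enum s.
case: (enum s) => [|i [|j []]] //= m /andP[ij _] _; exists i, j; split=> //.
by apply/setP => a; rewrite -m !inE.
Qed.

Lemma card3_sorted (s : {set 'I_n.+1}) : #|s| = 3 ->
  exists i j l : 'I_n.+1, [/\ (i < j)%N, (j < l)%N & s = [set i; j; l]].
Proof.
rewrite cardE; have := sorted_enum_set s; have := mem_enum s.
case: (enum s) => [|i [|j [|l []]]] //= m /and3P[ij jl _] _.
by exists i, j, l; split=> //; apply/setP => a; rewrite -m !inE orbA.
Qed.

Lemma cech_diff2 c (i j : 'I_n.+1) : (i < j)%N ->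
  cech_diff c [set i; j] = c [set j] - c [set i].
Proof.
move=> ij; have nij : i != j by apply: contraTneq ij => ->; rewrite ltnn.
rewrite /cech_diff big_setU1 ?inE //= big_set1; congr (_ + _).
  rewrite (_ : [set a in _ | _] = set0) ?cards0 ?mul1r.
    by congr c; rewrite setU1K // inE.
  apply/setP => a; rewrite !inE; apply/negP => /andP[/orP[]/eqP->]; rewrite ?ltnn //.
  by rewrite ltnNge ltnW.
rewrite (_ : [set a in _ | _] = [set i]) ?cards1 ?expr1 ?mulN1r.
  congr (- c _); apply/setP => a; rewrite !inE.
  by case: (eqVneq a j) => [->|]; rewrite ?orbF //= eq_sym (negPf nij).
apply/setP => a; rewrite !inE.
case: (eqVneq a i) => [->|ai] /=.
by rewrite ij.
by case: eqP => [->|] //=; rewrite ltnn.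
Qed.

Lemma cech_diff3 c (i j l : 'I_n.+1) : (i < j)%N -> (j < l)%N ->
  cech_diff c [set i; j; l] = c [set j; l] - c [set i; l] + c [set i; j].
Proof.
move=> ij jl; have il := ltn_trans ij jl.
have neq (a b : 'I_n.+1) : (a < b)%N -> (a == b = false) * (b == a = false).
  by move=> ab; rewrite [b == a]eq_sym -val_eqE /= (ltn_eqF ab).
have nlt (a b : 'I_n.+1) : (a < b)%N -> (b < a)%N = false.
  by move=> ab; rewrite ltnNge ltnW.
rewrite /cech_diff setUC big_setU1 ?inE /=; last first.
  by rewrite !(neq _ _ il, neq _ _ jl).
rewrite big_setU1 ?inE /=; last by rewrite (neq _ _ ij).
rewrite big_set1.
have -> : [set a in l |: [set i; j] | (a < l)%N] = [set i; j].
  apply/setP => a; rewrite !inE; case: (eqVneq a l) => [->|] /=.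
    by rewrite ltnn !(neq _ _ il, neq _ _ jl).
  by move=> _; apply: andb_idr => /orP[]/eqP->.
have -> : [set a in l |: [set i; j] | (a < i)%N] = set0.
  apply/setP => a; rewrite !inE; apply/negP => /andP[/or3P[]/eqP->].
  - by rewrite nlt.
  - by rewrite ltnn.
  - by rewrite nlt.
have -> : [set a in l |: [set i; j] | (a < j)%N] = [set i].
  apply/setP => a; rewrite !inE; case: (eqVneq a i) => [->|ai] /=.
    by rewrite ij !orbT.
  apply/negP => /andP[/orP[]/eqP->]; first by rewrite nlt.
  by rewrite ltnn.
rewrite cards0 cards1 cards2 (neq _ _ ij) /=.
have -> : (l |: [set i; j]) :\ l = [set i; j].
  by rewrite setU1K // !inE !(neq _ _ il, neq _ _ jl).
have -> : (l |: [set i; j]) :\ i = [set j; l].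
  apply/setP => a; rewrite !inE; case: (eqVneq a i) => [->|] /=.
    by rewrite (neq _ _ ij) (neq _ _ il).
  by rewrite orbC.
have -> : (l |: [set i; j]) :\ j = [set i; l].
  apply/setP => a; rewrite !inE; case: (eqVneq a j) => [->|] /=.
    by rewrite (neq _ _ ij) (neq _ _ jl).
  by rewrite orbF orbC.
by rewrite expr0 expr1 sqrrN expr1n; ring.
Qed.

Lemma section_glue i j a b e F G : i != j -> F \is e.-homog ->
  tofrac F / coordf i ^+ a = tofrac G / coordf j ^+ b ->
  exists2 Q, Q \is (e - a).-homog & F = 'X_i ^+ a * Q.
Proof.
move=> ij hF /eqP; rewrite eqr_div ?coordf_neq0 // -!tofracXn -!tofracM tofrac_eq.
move/eqP; rewrite ![_ * 'X__ ^+ _]mulrC => e1.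
exact: (mvarX_gauss ij hF e1).
Qed.

Lemma twist_section2_lift I d i j g : i != j -> twist_section I d%:Z [set i; j] g ->
  exists N0, forall N, (N0 <= N)%N -> exists2 F, F \is (d + N * 2).-homog
    & g = tofrac F / (coordf i * coordf j) ^+ N.
Proof.
move=> ij /twist_section2P-/(_ ij)[N0 [F [_ hF ->]]]; exists N0 => N /subnKC eN.
exists (('X_i * 'X_j) ^+ (N - N0) * F).
  have -> : (d + N * 2 = (1 + 1) * (N - N0) + (d + N0 * 2))%N.
    by lia.
  by rewrite dhomogM // dhomogMn // dhomogM ?dhomog_mvar.
have nz M : (coordf i * coordf j) ^+ M != 0.
  by rewrite exprMn mulf_neq0 ?coordf_neq0.
rewrite -{2}eN exprD tofracM tofracXn tofracM -/(coordf i) -/(coordf j).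
by rewrite -fraction_lift.
Qed.

(** The triples containing the chart 0 suffice.  The triple (0, 1, 2) splits
    c_01 as b_1 - b_0 by the syzygy lemma, and b_i := c_0i + b_0 is then forced.
    It is regular on chart i: its other poles can only be along X_0, but by the
    triple (0, 1, i) it also equals c_1i + b_1, whose other poles can only be
    along X_1. *)
Lemma line_bundle_H1 c d : (2 <= n)%N ->
  (forall s : {set 'I_n.+1}, #|s| = 2 -> twist_section (fun=> True) d%:Z s (c s)) ->
  (forall t : {set 'I_n.+1}, #|t| = 3 -> cech_diff c t = 0) ->
  exists b : 'I_n.+1 -> frac,
    (forall i, exists M G, G \is (d + M).-homog /\ b i = tofrac G / coordf i ^+ M) /\
    forall i j : 'I_n.+1, (i < j)%N -> c [set i; j] = b j - b i.
Proof.
move=> n2 sec coc.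
have neq (i j : 'I_n.+1) : (i < j)%N -> i != j.
  by move=> ij; rewrite -val_eqE /= (ltn_eqF ij).
have lift (i j : 'I_n.+1) (ij : (i < j)%N) : exists N0, forall N, (N0 <= N)%N ->
    exists2 F, F \is (d + N * 2).-homog &
      c [set i; j] = tofrac F / (coordf i * coordf j) ^+ N.
  by apply: (twist_section2_lift (neq _ _ ij)); apply: sec; rewrite cards2 neq.
have triple (i j l : 'I_n.+1) : (i < j)%N -> (j < l)%N -> c [set i; l] = c [set j; l] + c [set i; j].
  move=> ij jl; apply/esym/eqP; rewrite -subr_eq0 addrAC -cech_diff3 ?coc //.
  by rewrite -setUA cardsU1 !inE negb_or cards2 !neq ?(ltn_trans ij jl).
pose o0 : 'I_n.+1 := ord0.
pose o1 : 'I_n.+1 := Ordinal (ltnW n2 : (1 < n.+1)%N).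
pose o2 : 'I_n.+1 := Ordinal (n2 : (2 < n.+1)%N).
have [N01 l01] := lift o0 o1 isT; have [N12 l12] := lift o1 o2 isT.
have [N02 l02] := lift o0 o2 isT.
pose N := (N01 + N12 + N02)%N.
have [F01 h01 e01] := l01 N (leq_trans (leq_addr _ _) (leq_addr _ _)).
have [F12 h12 e12] := l12 N (leq_trans (leq_addl _ _) (leq_addr _ _)).
have [F02 h02 e02] := l02 N (leq_addl _ _).
have syz : 'X_o2 ^+ N * F01 = 'X_o0 ^+ N * (- F12) + 'X_o1 ^+ N * F02.
  have := triple o0 o1 o2 isT isT; rewrite e01 e12 e02 => e.
  apply/eqP; rewrite -tofrac_eq tofracD !tofracM tofracN !tofracXn.
  rewrite -/(coordf o0) -/(coordf o1) -/(coordf o2); apply/eqP.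
  by move: e; rewrite !exprMn; apply: cocycle_numerators; apply: coordf_neq0.
have [//|//|Q1 [Q2 [hQ1 hQ2 eF01]]] := mvarX_syzygy _ _ h01 syz.
have degQ : (d + N * 2 - N = d + N)%N by lia.
rewrite degQ in hQ1 hQ2.
pose b0 := - tofrac Q2 / coordf o0 ^+ N; pose b1 := tofrac Q1 / coordf o1 ^+ N.
have c01 : c [set o0; o1] = b1 - b0.
  rewrite e01 eF01 /b0 /b1 tofracD !tofracM !tofracXn !exprMn.
  by rewrite -/(coordf o0) -/(coordf o1) fraction_split ?coordf_neq0.
pose b i := if i == o0 then b0 else c [set o0; i] + b0.
exists b; split; last first.
  move=> i j ij; have j0 : j != o0 by rewrite -val_eqE /= -lt0n (leq_ltn_trans _ ij).
  rewrite /b (negPf j0); have [->|i0] := eqVneq i o0; first by rewrite addrK.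
  by rewrite (triple o0 i j) ?lt0n //; ring.
move=> i; rewrite /b; have [->|i0] := eqVneq i o0.
  by exists N, (- Q2); rewrite rpredN tofracN.
have [->|i1] := eqVneq i o1.
  by exists N, Q1; rewrite c01 subrK.
have lt0i : (o0 < i)%N by rewrite lt0n.
have lt1i : (o1 < i)%N.
  by move: i0 i1; rewrite -!val_eqE /=; case: (val i) => [|[]].
have [N0 l0] := lift o0 i lt0i; have [N1 l1] := lift o1 i lt1i.
pose M := (N0 + N1)%N.
have [F0 h0 e0] := l0 M (leq_addr _ _); have [F1 h1 e1] := l1 M (leq_addl _ _).
have g1 : c [set o0; i] + b0 = c [set o1; i] + b1.
  by rewrite (triple o0 o1 i) // c01; ring.
pose H0 := 'X_o0 ^+ N * F0 - 'X_o0 ^+ M * 'X_i ^+ M * Q2.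
pose H1 := 'X_o1 ^+ N * F1 + 'X_o1 ^+ M * 'X_i ^+ M * Q1.
have E0 : c [set o0; i] + b0 = tofrac H0 / coordf o0 ^+ (M + N) / coordf i ^+ M.
  rewrite e0 /b0 /H0 tofracB !tofracM !tofracXn !exprMn exprD.
  by rewrite -mulrN -/(coordf o0) -/(coordf i) fraction_sum ?coordf_neq0.
have E1 : c [set o1; i] + b1 = tofrac H1 / coordf o1 ^+ (M + N) / coordf i ^+ M.
  rewrite e1 /b1 /H1 tofracD !tofracM !tofracXn !exprMn exprD.
  by rewrite -/(coordf o1) -/(coordf i) fraction_sum ?coordf_neq0.
have hH0 : H0 \is (d + M * 2 + N).-homog.
  rewrite rpredB //; first by rewrite addnC dhomogM // dhomog_mvarX.
  have -> : (d + M * 2 + N = M + M + (d + N))%N by move: (M) (N); clear; lia.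
  by rewrite !dhomogM // dhomog_mvarX.
have eqH : tofrac H0 / coordf o0 ^+ (M + N) = tofrac H1 / coordf o1 ^+ (M + N).
  apply: (mulIf (invr_neq0 (coordf_neq0 i M))); rewrite -E0 -E1; exact: g1.
have [//|Q hQ eQ] := section_glue _ hH0 eqH.
exists M, Q; split.
  move: hQ; have -> // : (d + M * 2 + N - (M + N) = d + M)%N.
  by move: (M) (N); clear; lia.
rewrite E0 eQ tofracM tofracXn -/(coordf o0) [_ * tofrac Q]mulrC mulfK //.
exact: coordf_neq0.
Qed.

End CechPairs.

(** * Vanishing of the first cohomology makes jets independent *)

Section CechToJets.
Variables (k : fieldType) (n : nat).
Local Notation frac := {fraction {mpoly k[n.+1]}}.
Implicit Types (A : {fset proj_space k n}) (F G : {mpoly k[n.+1]}).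
Implicit Types (P v : 'rV[k]_n.+1).
Local Notation ev P F := (F.@[fun i => P 0 i]).

(** Let h be a form of degree e vanishing at the points of A other than p and
    scaled so that h(p) = X_i(p)^e, and put x = X_i^e.  Then t_i = h^2 (3x - 2h) is
    singular at the other points, and x^3 - t_i = (x + 2h)(x - h)^2 is singular at
    p.  This covers the case X_i(p) = 0 too, where h = 0. *)
Lemma local_bump A p : exists N (t : 'I_n.+1 -> {mpoly k[n.+1]}),
  forall i, [/\ t i \is N.-homog, singular_at (repr_vec p) ('X_i ^+ N - t i) &
    forall q, q \in A -> q != p -> singular_at (repr_vec q) (t i)].
Proof.
have [h hh [h1 h0]] := separating_form p (enum_fset A).
move: (size _) hh => e hh; pose P := repr_vec p.
pose hi i := P 0 i ^+ e *: h.
exists (e * 2 + e)%N, (fun i => hi i ^+ 2 * (3%:R *: 'X_i ^+ e - 2%:R *: hi i)) => i.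
have hhi : hi i \is e.-homog by rewrite dhomogZ.
split.
- by rewrite dhomogM ?dhomogMn // rpredB // dhomogZ // dhomog_mvarX.
- have vh : ev P ('X_i ^+ e - hi i) = 0.
    by rewrite mevalB mevalZ rmorphXn /= mevalXU h1 mulr1 subrr.
  have -> : 'X_i ^+ (e * 2 + e) - hi i ^+ 2 * (3%:R *: 'X_i ^+ e - 2%:R *: hi i) =
      ('X_i ^+ e + 2%:R * hi i) * (('X_i ^+ e - hi i) * ('X_i ^+ e - hi i)).
    rewrite exprD exprM; move: (_ ^+ e) (hi i) => x y.
    by rewrite !scaler_nat; ring.
  by apply: singular_atMl; apply: singular_atM.
move=> q qA qp; rewrite mulrC; apply: singular_atMl.
by apply: singular_atM; rewrite mevalZ h0 ?mulr0.
Qed.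

Section Char0.
Hypothesis char0 : [pchar k] =i pred0.

Lemma exists_nonzero_dirder d P v : (0 < d)%N -> P != 0 -> v != 0 ->
  exists2 F, F \is d.-homog & dirder v P F != 0.
Proof.
case: d => // d _ /rV0Pn[i Pi] /rV0Pn[j vj].
have [vi|vi] := eqVneq (v 0 i) 0.
  exists ('X_i ^+ d * 'X_j).
    have := dhomogM (dhomog_mvarX k i d) (dhomog_mvar k j); by rewrite addn1.
  rewrite dirderM dirderX !dirder_mvar vi mulr0 mul0r add0r rmorphXn /= mevalXU.
  by rewrite mulf_neq0 ?expf_neq0.
exists ('X_i ^+ d.+1); first exact: dhomog_mvarX.
by rewrite dirderX dirder_mvar mevalXU !mulf_neq0 ?expf_neq0 ?natr_neq0.
Qed.

(** Suppose that u is a dependency with u_p <> 0.  Take phi with nonzero derivative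
    along u_p at p, and let phi t_i / X_i^N be its bumped copy on chart i, which has
    the 1-jet of phi at p and zero 1-jets at the other points.  The differences of
    these copies are sections of I(A)^2.  If a multiple by la of this cocycle
    bounds, correcting the copies makes them agree, hence gives a global form f
    with the 1-jet of la phi at p and zero 1-jets elsewhere; the dependency applied
    to f shows that la = 0. *)
Lemma h1_zero_jets_independent A d : (0 < d)%N -> (0 < n)%N ->
  h_double_eq0 1 A d%:Z -> jets_independent A d.
Proof.
move=> d0 n0 [_ h1] u dep p pA; apply/eqP/negPn/negP => up; apply: h1.
have [phi hphi phi1] := exists_nonzero_dirder d0 (repr_vec_neq0 p) up.
have [N [t ht]] := local_bump A p.
pose G i := phi * t i.
have hG i : G i \is (d + N).-homog by rewrite dhomogM //; case: (ht i).
have [M hM] := singular_times_power_in_square A.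
pose b0 i : frac := tofrac (G i) / coordf k i ^+ N.
pose b (s : {set 'I_n.+1}) := \sum_(i in s) b0 i.
have b1 i : b [set i] = b0 i by rewrite /b big_set1.
have diff_b (i j : 'I_n.+1) : (i < j)%N -> cech_diff b [set i; j] = b0 j - b0 i.
  by move=> ij; rewrite cech_diff2 // !b1.
exists (fun=> cech_diff b); split=> [_|lam].
  split=> s cs.
    have [i [j [ij ->]]] := card2_sorted cs.
    have nij : i != j by rewrite -val_eqE /= (ltn_eqF ij).
    rewrite diff_b //; apply/(twist_section2P _ _ _ nij).
    pose K := 'X_i ^+ N * G j - 'X_j ^+ N * G i.
    have hK : K \is (d + N * 2).-homog.
      have -> : (d + N * 2 = N + (d + N))%N by clear; lia.
      by rewrite rpredB // dhomogM // dhomog_mvarX.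
    have sK q : q \in A -> singular_at (repr_vec q) K.
      move=> qA; have [_ si zi] := ht i; have [_ sj zj] := ht j.
      have [->|qp] := eqVneq q p.
        have -> : K = phi * ('X_j ^+ N * ('X_i ^+ N - t i))
                      - phi * ('X_i ^+ N * ('X_j ^+ N - t j)).
          by rewrite /K /G; move: (_ ^+ N) (_ ^+ N) => x y; ring.
        by apply: singular_atB; do 2![apply: singular_atMl].
      by apply: singular_atB; do 2![apply: singular_atMl]; [apply: zj|apply: zi].
    exists (M + N)%N, (('X_i * 'X_j) ^+ M * K); split.
    - rewrite exprMn [_ * 'X_j ^+ M]mulrC -mulrA; apply: double_idealM.
      exact: hM hK sK.
    - have -> : (d + (M + N) * 2 = (1 + 1) * M + (d + N * 2))%N by clear; lia.
      by rewrite dhomogM // dhomogMn // dhomogM ?dhomog_mvar.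
    have -> : b0 j - b0 i = tofrac K / (coordf k i * coordf k j) ^+ N.
      rewrite /b0 fraction_sub ?coordf_neq0 // -exprMn tofracB.
      by rewrite [tofrac (_ * G j)]tofracM [tofrac (_ * G i)]tofracM !tofracXn.
    rewrite tofracM tofracXn tofracM addnC exprD.
    by rewrite -fraction_lift // exprMn mulf_neq0 ?coordf_neq0.
  have [i [j [l [ij jl ->]]]] := card3_sorted cs.
  rewrite cech_diff3 // !diff_b ?(ltn_trans ij jl) //.
  by move: (b0 i) (b0 j) (b0 l) => x y z; ring.
move=> [b' hb' eb'] j; rewrite (ord1 j) {j}.
set la := lam ord0.
have /fin_all_exists[N' /fin_all_exists[F hF]] i : exists N' F,
    [/\ double_ideal A F, F \is (d + N').-homog
      & b' [set i] = tofrac F / coordf k i ^+ N'].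
  by apply/twist_section1P; apply: hb'; rewrite cards1.
pose H i := 'X_i ^+ N' i * (la *: G i) - 'X_i ^+ N * F i.
have hH i : H i \is (d + (N + N' i)).-homog.
  have [_ hFi _] := hF i.
  rewrite rpredB //; last by rewrite addnCA dhomogM // dhomog_mvarX.
  by rewrite addnA addnC dhomogM ?dhomog_mvarX // dhomogZ.
(* the corrected local sections, which glue to the global form f *)
pose g i := tofrac la%:MP * b0 i - b' [set i].
have gE i : g i = tofrac (H i) / coordf k i ^+ (N + N' i).
  have [_ _ e] := hF i; rewrite /g e /b0 mulrA fraction_sub ?coordf_neq0 // mulrC.
  rewrite /H -mul_mpolyC tofracB [tofrac (_ * (_ * _))]tofracM.
  rewrite [tofrac (_ * G i)]tofracM [tofrac (_ * F i)]tofracM !tofracXn.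
  by rewrite exprD [coordf k i ^+ N * _]mulrC mulrC.
have g_eq_lt (i l : 'I_n.+1) : (i < l)%N -> g i = g l.
  move=> il; have nil : i != l by rewrite -val_eqE /= (ltn_eqF il).
  have := eb' [set i; l]; rewrite cards2 nil big_ord1 diff_b // cech_diff2 // => /(_ erefl).
  rewrite -/la mulrBr /g; move: (_ * b0 i) (_ * b0 l) (b' [set i]) (b' [set l]).
  move=> xi xl yi yl e; apply/eqP; rewrite -subr_eq0.
  have -> : xi - yi - (xl - yl) = yl - yi - (xl - xi) by ring.
  by rewrite e subrr.
have g_eq i l : g i = g l.
  have [il|li|/val_inj->//] := ltngtP i l; first exact: g_eq_lt.
  by rewrite (g_eq_lt l i).
pose o0 : 'I_n.+1 := ord0; pose o1 : 'I_n.+1 := Ordinal (n0 : (1 < n.+1)%N).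
have e01 : tofrac (H o0) / coordf k o0 ^+ (N + N' o0) =
    tofrac (H o1) / coordf k o1 ^+ (N + N' o1) by rewrite -!gE.
have [//|f hf eH0] := section_glue _ (hH o0) e01.
rewrite addnK in hf.
have eH i : H i = 'X_i ^+ (N + N' i) * f.
  apply/eqP; rewrite -tofrac_eq tofracM tofracXn -/(coordf k i).
  have := g_eq i o0; rewrite !gE eH0 tofracM tofracXn -/(coordf k o0).
  rewrite [_ * tofrac f]mulrC mulfK ?coordf_neq0 // => <-.
  by rewrite mulrCA mulfV ?mulr1 ?coordf_neq0.
have := dep f hf; rewrite (big_fsetD1 p) //= big_seq big1 ?addr0 => [|q]; last first.
  rewrite in_fsetD1 => /andP[qp qA]; have [i qi] := coord_neq0 q.
  have [dF _ _] := hF i; have [_ _ ti] := ht i.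
  suff [_ ->//] : singular_at (repr_vec q) f.
  apply: (@singular_at_cancel _ _ _ _ ('X_i ^+ (N + N' i))).
    by rewrite rmorphXn /= mevalXU expf_neq0.
  rewrite -eH; apply: singular_atB; apply: singular_atMl.
    by rewrite -mul_mpolyC /G mulrA; apply: singular_atMl; apply: ti.
  exact: double_ideal_singular dF qA.
have [i pi] := coord_neq0 p; have [dF _ _] := hF i; have [_ ti _] := ht i.
have : singular_at (repr_vec p) (f - la *: phi).
  apply: (@singular_at_cancel _ _ _ _ ('X_i ^+ (N + N' i))).
    by rewrite rmorphXn /= mevalXU expf_neq0.
  have -> : 'X_i ^+ (N + N' i) * (f - la *: phi) =
      - (la%:MP * phi * 'X_i ^+ N' i) * ('X_i ^+ N - t i) - 'X_i ^+ N * F i.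
    rewrite mulrBr -eH /H /G -!mul_mpolyC exprD.
    by move: (_ ^+ N) (_ ^+ N' i) (la%:MP) => x y z; ring.
  by apply: singular_atB; apply: singular_atMl => //; apply: double_ideal_singular dF pA.
case=> _ /(_ (u p)); rewrite linearB linearZ /= => /eqP; rewrite subr_eq0 => /eqP -> /eqP.
by rewrite mulf_eq0 (negPf phi1) orbF => /eqP.
Qed.

End Char0.
End CechToJets.

(** * Independence of jets kills the first cohomology *)

Section JetsToCech.
Variables (k : fieldType) (n : nat).
Local Notation frac := {fraction {mpoly k[n.+1]}}.
Implicit Types (A S : {fset proj_space k n}) (F G : {mpoly k[n.+1]}).
Implicit Types (P v : 'rV[k]_n.+1).
Local Notation ev P F := (F.@[fun i => P 0 i]).

Hypothesis char0 : [pchar k] =i pred0.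

(** The gradient at P of G / X_i^M, computed by the quotient rule. *)
Definition quotient_jet (i : 'I_n.+1) M P G : 'rV[k]_n.+1 :=
  \row_a ((ev P G^`M(a) - ev P G / P 0 i ^+ M * ev P ('X_i ^+ M)^`M(a)) / P 0 i ^+ M).

Lemma quotient_jetP i M d P F G : (0 < d)%N -> P 0 i != 0 ->
  F \is d.-homog -> G \is (d + M).-homog ->
  (forall v, dirder v P F = dot v (quotient_jet i M P G)) ->
  singular_at P (G - 'X_i ^+ M * F).
Proof.
move=> d0 Pi hF hG jetF; have Xi : ev P ('X_i ^+ M) = P 0 i ^+ M.
  by rewrite rmorphXn /= mevalXU.
have XM : P 0 i ^+ M != 0 by rewrite expf_neq0.
have jetE v : dirder v P F =
    (dirder v P G - ev P G / P 0 i ^+ M * dirder v P ('X_i ^+ M)) / P 0 i ^+ M.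
  rewrite jetF /dot /dirder mulr_sumr -sumrB mulr_suml; apply: eq_bigr => a _.
  by rewrite mxE; ring.
have FP : ev P F = ev P G / P 0 i ^+ M.
  have d1 : (d%:R : k) != 0 by case: (d) d0 => // d' _; rewrite natr_neq0.
  apply: (mulfI d1); rewrite -(euler_identity P hF) jetE (euler_identity P hG).
  rewrite (euler_identity P (dhomog_mvarX k i M)) Xi natrD.
  by move: XM; move: (_ ^+ M) => x x0; field.
split=> [|v]; first by rewrite mevalB mevalM Xi FP mulrC divfK ?subrr.
rewrite linearB /= dirderM Xi FP jetE.
by move: XM; move: (_ ^+ M) (dirder v P ('X_i ^+ M)) => x y x0; field.
Qed.

(** Let b_i = G_i / X_i^M_i be a cochain of O(d) with coboundary c.  Since c is
    singular along A, the 1-jet of b_i at a point p does not depend on the chart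
    containing p, so one form f of degree d realizes all these 1-jets, and b - f
    still bounds c.  Its numerators H_i are singular at the points of A in chart i;
    two more factors X_i make them singular at the points outside, and further
    ones put them into I(A)^2. *)
Lemma jets_independent_h1_zero A d : (0 < d)%N -> (2 <= n)%N ->
  jets_independent A d -> h_double_eq0 1 A d%:Z.
Proof.
move=> d0 n2 ind; split.
  by exists (fun _ _ => 0); split=> [[]|? ? []].
move=> [u [/(_ ord0)[sec coc] indep]].
set c := u ord0 in sec coc.
suff cob : cech_coboundary (double_ideal A) d%:Z 1
    (fun s => \sum_(j < 1) tofrac 1%:MP * u j s).
  by have /eqP := indep (fun=> 1) cob ord0; rewrite oner_eq0.
have [|b [/fin_all_exists[M /fin_all_exists[G hG]] cb]] :=
  line_bundle_H1 n2 (c := c) (d := d) _ coc.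
  by move=> s /sec[N [e [F [_ ? ? ?]]]]; exists N, e, F.
pose chart (p : proj_space k n) := xchoose (coord_neq0 p).
have chartP p : repr_vec p 0 (chart p) != 0 by exact: (xchooseP (coord_neq0 p)).
have [f hf jetf] := jets_independent_surjective
  (fun p => quotient_jet (chart p) (M (chart p)) (repr_vec p) (G (chart p))) ind.
pose H i := G i - 'X_i ^+ M i * f.
have hH i : H i \is (d + M i).-homog.
  have [hGi _] := hG i.
  by rewrite rpredB // addnC dhomogM // dhomog_mvarX.
have sing_chart p : p \in A -> singular_at (repr_vec p) (H (chart p)).
  move=> pA; have [hGi _] := hG (chart p).
  by apply: (quotient_jetP d0 (chartP p) hf hGi) => v; apply: jetf.
have compat (i j : 'I_n.+1) p : (i < j)%N -> p \in A ->
    repr_vec p 0 i != 0 -> repr_vec p 0 j != 0 ->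
    singular_at (repr_vec p) ('X_i ^+ M i * G j - 'X_j ^+ M j * G i).
  move=> ij pA pi pj; have nij : i != j by rewrite -val_eqE /= (ltn_eqF ij).
  have /(twist_section2P _ _ _ nij)[N [F [dF _ e]]] :
      twist_section (double_ideal A) d%:Z [set i; j] (c [set i; j]).
    by apply: sec; rewrite cards2 nij.
  apply: (@singular_at_cancel _ _ _ _ (('X_i * 'X_j) ^+ N)).
    by rewrite rmorphXn /= mevalM !mevalXU expf_neq0 // mulf_neq0.
  have -> : ('X_i * 'X_j) ^+ N * ('X_i ^+ M i * G j - 'X_j ^+ M j * G i) =
            'X_i ^+ M i * 'X_j ^+ M j * F.
    apply/eqP; rewrite -tofrac_eq; apply/eqP.
    have [_ bi] := hG i; have [_ bj] := hG j.
    have := cb i j ij; rewrite e bi bj fraction_sub ?coordf_neq0 //.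
    move/eqP; rewrite eqr_div ?mulf_neq0 ?expf_neq0 ?mulf_neq0 ?(coordf_neq0 _ _ 1) //.
    rewrite ![tofrac (_ * (_ - _))]tofracM tofracB.
    rewrite [tofrac (_ * G i)]tofracM [tofrac (_ * G j)]tofracM [tofrac (_ * F)]tofracM.
    rewrite [tofrac (_ ^+ _ * _ ^+ _)]tofracM !tofracXn tofracM.
    by move/eqP; rewrite mulrC => ->; rewrite mulrC.
  by apply: singular_atMl; apply: double_ideal_singular dF pA.
have sing i p : p \in A -> repr_vec p 0 i != 0 -> singular_at (repr_vec p) (H i).
  move=> pA pi; have := sing_chart p pA; move: (chartP p); move: (chart p) => j pj sj.
  have [->//|nij] := eqVneq i j.
  apply: (@singular_at_cancel _ _ _ _ ('X_j ^+ M j)).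
    by rewrite rmorphXn /= mevalXU expf_neq0.
  have compat' : singular_at (repr_vec p) ('X_j ^+ M j * G i - 'X_i ^+ M i * G j).
    have [ij|ji|/val_inj e] := ltngtP i j; last by rewrite e eqxx in nij.
      by rewrite -opprB -mulN1r; apply/singular_atMl/compat.
    exact: compat.
  have -> : 'X_j ^+ M j * H i =
      ('X_j ^+ M j * G i - 'X_i ^+ M i * G j) + 'X_i ^+ M i * H j.
    by rewrite /H; move: (_ ^+ M i) (_ ^+ M j) (G i) (G j) => ? ? ? ?; ring.
  by apply: singular_atD => //; apply: singular_atMl.
have sing2 i p : p \in A -> singular_at (repr_vec p) ('X_i ^+ 2 * H i).
  move=> pA; have [pi|pi] := eqVneq (repr_vec p 0 i) 0.
    rewrite mulrC; apply: singular_atMl.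
    by apply: singular_atM; rewrite mevalXU.
  by apply: singular_atMl; apply: sing.
have [E hE] := singular_times_power_in_square A.
pose b' (s : {set 'I_n.+1}) := \sum_(i in s) (b i - tofrac f).
exists b' => [s|s] cs.
  have /cards1P[i ->] : #|s| == 1%N by rewrite cs.
  apply/twist_section1P; rewrite /b' big_set1.
  have hH2 : 'X_i ^+ 2 * H i \is (2 + (d + M i)).-homog.
    by rewrite dhomogM // dhomog_mvarX.
  exists (E + 2 + M i)%N, ('X_i ^+ E * ('X_i ^+ 2 * H i)); split.
  - by apply: hE hH2 _ => p; apply: sing2.
  - have -> : (d + (E + 2 + M i) = E + (2 + (d + M i)))%N.
      by move: (M i) => m; clear; lia.
    by rewrite dhomogM // dhomog_mvarX.
  have [_ ->] := hG i.
  have -> : tofrac (G i) / coordf k i ^+ M i - tofrac f =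
      tofrac (H i) / coordf k i ^+ M i.
    rewrite tofracB tofracM tofracXn mulrBl; congr (_ - _).
    by rewrite mulrAC mulfV ?mul1r // coordf_neq0.
  rewrite mulrA -exprD tofracM tofracXn [(E + 2 + M i)%N]addnC [coordf k i ^+ (M i + _)]exprD.
  by rewrite -fraction_lift ?coordf_neq0.
have [i [j [ij ->]]] := card2_sorted cs.
rewrite big_ord1 mpolyC1 tofrac1 mul1r -/c cb // cech_diff2 //.
by rewrite /b' !big_set1; ring.
Qed.

(** Such a section is a constant, because it is regular on two charts and its
    degree is at most 0, and the constant is 0 because it vanishes at a point. *)
Lemma h0_nonpos_zero A (t : int) : (0 < n)%N -> A != fset0 -> t <= 0 ->
  ~ h_double_pos 0 A t.
Proof.
move=> n0 /fset0Pn[p pA] t0 [u [/(_ ord0)[sec coc] indep]].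
suff zero (s : {set 'I_n.+1}) : #|s| = 1%N -> u ord0 s = 0.
  have cob : cech_coboundary (double_ideal A) t 0
      (fun s => \sum_(j < 1) tofrac 1%:MP * u j s).
    by move=> s cs; rewrite big_ord1 zero ?mulr0.
  by have /eqP := indep (fun=> 1) cob ord0; rewrite oner_eq0.
pose g i := u ord0 [set i].
have g_eq_lt (i l : 'I_n.+1) : (i < l)%N -> g i = g l.
  move=> il; have nil : i != l by rewrite -val_eqE /= (ltn_eqF il).
  have := coc [set i; l]; rewrite cards2 nil => /(_ erefl).
  by rewrite cech_diff2 // => /eqP; rewrite subr_eq0 => /eqP.
have g_eq i l : g i = g l.
  have [il|li|/val_inj->//] := ltngtP i l; first exact: g_eq_lt.
  by rewrite (g_eq_lt l i).
suff [i gi] : exists i, g i = 0.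
  by move/eqP/cards1P => [l ->]; rewrite -/(g l) (g_eq l i).
have [i pi] := coord_neq0 p; exists i.
have [j ij] : exists j, i != j.
  have [->|i0] := eqVneq i ord0; first by exists (Ordinal (n0 : (1 < n.+1)%N)).
  by exists ord0.
have [|N [e [F [dF hF he gi]]]] := sec [set i]; first by rewrite cards1.
have [|N' [e' [F' [_ _ _ gj]]]] := sec [set j]; first by rewrite cards1.
rewrite !big_set1 -/(g _) in gi gj.
have eij : tofrac F / coordf k i ^+ N = tofrac F' / coordf k j ^+ N'.
  by rewrite -gi -gj; apply: g_eq.
have [Q hQ eF] := section_glue ij hF eij.
have eN : (e - N = 0)%N.
  by move: he t0; rewrite cards1 muln1; clear; lia.
rewrite eN in hQ.
have [QF _] := double_ideal_singular dF pA.
have Q0 : ev (repr_vec p) Q = 0.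
  move/eqP: QF; rewrite eF mevalM rmorphXn /= mevalXU mulf_eq0.
  by rewrite expf_eq0 (negPf pi) andbF => /eqP.
have : Q = 0.
  apply/mpolyP => m; rewrite mcoeff0; apply/eqP/negPn/negP.
  rewrite -mcoeff_msupp => mQ.
  have m0 : m = 0%MM.
    by apply/eqP; rewrite -mdeg_eq0; move/dhomogP: hQ => /(_ m mQ)/eqP.
  have eQ : Q = (Q@_0)%:MP.
    apply/mpolyP => l; rewrite mcoeffC; have [->|nl] := eqVneq l 0%MM.
      by rewrite mulr1.
    by rewrite mulr0; apply: (dhomog_nemf_coeff hQ); rewrite /= mdeg_eq0.
  by move: Q0 mQ; rewrite eQ mevalC => ->; rewrite mpolyC0 msupp0.
by move=> Q00; rewrite gi eF Q00 mulr0 tofrac0 mul0r.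
Qed.

End JetsToCech.

(** * Minimally Terracini sets *)

Theorem theorem3p1 (k : closedFieldType) (char0 : [pchar k] =i pred0)
    (n : nat) (hn : (2 <= n)%N) (d : int) (hd : 0 < d) (x : nat) (hx : (0 < x)%N)
    (S : {fset proj_space k n}) (hS : minimally_terracini d x S) :
  [/\ h_double_eq0 1 S (d + 1),
      forall t : int, d + 1 <= t -> ~ terracini t x S
    & forall t : int, t <= d - 1 -> ~ minimally_terracini t x S].
Proof.
have succ_independent e : (0 < e)%N -> minimally_terracini e%:Z x S ->
    jets_independent S e.+1.
  move=> e0 [[_ _ _ span] minS].
  apply: (jets_independent_of_minimal char0 e0 hn) span => A /minS.
  exact: (h1_zero_jets_independent char0 e0 (ltnW hn)).
have no_h1 e : (0 < e)%N -> jets_independent S e -> ~ h_double_pos 1 S e%:Z.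
  by move=> e0 /(jets_independent_h1_zero char0 e0 hn)[].
case: d hd hS => // d d0 hS; have indS := succ_independent d d0 hS.
split.
- by rewrite -PoszD addn1; apply: (jets_independent_h1_zero char0 _ hn).
- case=> // t; rewrite -PoszD lez_nat addn1 => dt [_ _ h1 _].
  apply: no_h1 h1; first exact: leq_trans dt.
  exact: (jets_independent_leq char0 _ dt indS).
move=> t td ht.
have [t0|t0] := leP t 0.
  have [[cS h0 _ _] _] := ht.
  by apply: (h0_nonpos_zero (ltnW hn)) t0 h0; rewrite -cardfs_gt0 cS.
case: t t0 td ht => // t t0 td ht.
have ltd : (t.+1 <= d)%N by move: td; clear; lia.
have [[_ _ h1 _] _] := hS; apply: no_h1 h1 => //.
exact: (jets_independent_leq char0 _ ltd (succ_independent t t0 ht)).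
Qed.
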